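(* Every class of antipodal metric spaces from Cherlin's list has EPPA. That is, for every integer $\delta$ and every $K$ with $1\leq K\leq \frac{\delta}{2}$ or $K=\delta$, the class $\mathcal A^\delta_K$ has EPPA.
   Context: A class $\mathcal C$ of finite structures has the extension property for partial automorphisms (EPPA) if for every $A\in\mathcal C$ there is $B\in\mathcal C$ such that $A$ is an (induced) substructure of $B$ and every isomorphism between substructures of $A$ extends to an automorphism of $B$. Metric spaces with distances in $\{0,1,\ldots,\delta\}$ are viewed as relational structures with binary symmetric irreflexive relations $R^1,\ldots,R^\delta$ (one per nonzero distance, every pair of distinct points in exactly one relation). Cherlin's list describes the classes of finite metric spaces embeddable into the path-metric space of a countable metrically homogeneous graph (a connected graph in which every distance-preserving map between finite vertex sets extends to an automorphism). Its antipodal classes are $\mathcal A^\delta_K$, where $1\leq K\leq \frac{\delta}{2}$ or $K=\delta$: $\mathcal A^\delta_K$ is the class of all finite metric spaces with distances in $\{0,1,\ldots,\delta\}$ containing no triangle with distances $a,b,c$ such that (1) $a+b+c>2\delta$, or (2) $a+b+c$ is odd and $a+b+c<2K$, or (3) $a+b+c$ is odd and $a+b+c>2(\delta-K)+2\min(a,b,c)$. The case $K=\delta$ gives the bipartite antipodal classes; the others are the non-bipartite ones. *)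

(* Defs.v *)
From HB Require Import structures.
From mathcomp Require Import all_boot all_fingroup.

Set Implicit Arguments.
Unset Strict Implicit.
Unset Printing Implicit Defensive.

Record structure (L : Type) := Structure {
  carrier :> finType;
  srel : L -> rel carrier
}.

Definition is_embedding (L : Type) (A B : structure L) (f : A -> B) : Prop :=
  injective f /\ forall (r : L) (x y : A), srel r (f x) (f y) = srel r x y.

Definition is_automorphism (L : Type) (B : structure L) (g : {perm B}) : Prop :=
  forall (r : L) (x y : B), srel r (g x) (g y) = srel r x y.

(* An isomorphism between the induced substructures on D and E is represented *)
(* by a total map p, of which only the restriction to D matters.              *)
Definition is_partial_iso (L : Type) (A : structure L) (D E : {set A})
    (p : A -> A) : Prop :=
  [/\ {in D &, injective p}, p @: D = E &
      forall r : L, {in D &, forall x y, srel r (p x) (p y) = srel r x y}].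

(* The inclusion of A in B is an embedding f; the copy of p inside B is then  *)
(* the map sending f x to f (p x) for x in D.                                 *)
Definition EPPA (L : Type) (C : structure L -> Prop) : Prop :=
  forall A : structure L, C A ->
  exists B : structure L, C B /\
  exists f : A -> B, is_embedding f /\
  forall (D E : {set A}) (p : A -> A), is_partial_iso D E p ->
  exists g : {perm B}, is_automorphism g /\ {in D, forall x, g (f x) = f (p x)}.

Definition is_metric (T : finType) (d : T -> T -> nat) : Prop :=
  [/\ forall x y, d x y = 0 <-> x = y,
      forall x y, d x y = d y x &
      forall x y z, d x z <= d x y + d y z].

(* The language is R^1, ..., R^delta; i : 'I_delta stands for R^(i+1).        *)
Definition represents_metric (delta : nat) (A : structure 'I_delta)
    (d : A -> A -> nat) : Prop :=
  [/\ is_metric d, forall x y, d x y <= delta &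
      forall (i : 'I_delta) (x y : A), srel i x y = (d x y == i.+1)].

Definition forbidden_triangle (delta K a b c : nat) : Prop :=
  [\/ 2 * delta < a + b + c,
      odd (a + b + c) /\ a + b + c < 2 * K |
      odd (a + b + c) /\ 2 * (delta - K) + 2 * minn a (minn b c) < a + b + c].

Definition antipodal_class (delta K : nat) (A : structure 'I_delta) : Prop :=
  exists d : A -> A -> nat, represents_metric d /\
  forall x y z : A, x <> y -> y <> z -> x <> z ->
    ~ forbidden_triangle delta K (d x y) (d y z) (d x z).

Arguments antipodal_class : clear implicits.

(* Main.v *)
Require Import Defs.
From HB Require Import structures.
From mathcomp Require Import all_boot all_fingroup.
From mathcomp Require Import zify.

(** Adjoin antipodes and allow partial, multivalued distances: a finite set with
a fixed-point-free involution and labelled edges, in which a label [a] from [x]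
to [y] comes with a label [delta - a] from the antipode of [x] to [y]. Such a
structure completes canonically to a space of the class as soon as no walk from
a point to its antipode is shorter than [delta] and no closed walk has odd length
below [2K]: one clamps a target value, as close to [delta / 2] as parity permits,
to the interval allowed by the shortest walks. When two values are equally close
to [delta / 2] the target is chosen by a bit attached to each pair of points,
which changes when a point is replaced by its antipode, as in the proof of EPPA
for two-graphs.

One starts from a structure containing all possible labels, where partial
isometries extend easily because the bits can be corrected by symmetric
matrices. Bad walks are then killed by increasing number of steps. In the double
cover attached to a shortest bad cycle the sheet changes exactly along one edge
of the cycle, so the cycle does not lift. A shortest bad cycle has no chord, so
the given space meets it in at most one edge; hence the space lifts to the
cover, and so do the automorphisms extending its partial isometries. *)

Set Implicit Arguments.
Unset Strict Implicit.
Unset Printing Implicit Defensive.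

(** * Systems with antipodes and their walks *)

Section Antipodal.
Variables delta K : nat.

Let bip := K == delta.

(* [edge] is a partial, possibly multivalued, distance; [target] is the distance *)
(* given to a pair on which short walks impose no constraint.                    *)
Record system := System {
  point :> finType;
  anti : point -> point;
  edge : point -> point -> nat -> bool;
  target : point -> point -> nat;
  antiK : involutive anti;
  anti_neq : forall x, anti x != x;
  edge_sym : forall x y a, edge x y a -> edge y x a;
  edge_anti : forall x y a, edge x y a -> edge (anti x) y (delta - a);
  edge_range : forall x y a, edge x y a -> 0 < a < delta;
  edge_neq : forall x y a, edge x y a -> (y != x) && (y != anti x);
  edge_parity : bip -> forall x y a, edge x y a -> odd a = odd (target x y);
  target_sym : forall x y, target x y = target y x;
  target_anti : forall x y, target (anti x) y = delta - target x y;
  target_le : forall x y, target x y <= delta;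
  target_gt0 : forall x y, 0 < target x y;
  target_lb : forall x y, delta <= (2 * target x y).+1 + bip;
  target_parity : bip -> forall x y z,
    odd (target x y) (+) odd (target y z) = odd (target x z)
}.

(** The effect on a label of passing to the antipode at one end of the edge. *)
Definition fl (b : bool) a := if b then delta - a else a.

Section Walks.
Variable V : system.
Implicit Types (x y z u v : V) (b c : bool) (a k m n : nat).

Definition flip (b : bool) x := if b then anti x else x.

(** Membership in a common antipodal pair. *)
Definition same x y := [exists b, y == flip b x].

Lemma flipK b : involutive (flip b).
Proof. by case: b => x //=; rewrite antiK. Qed.

Lemma flip_add b c x : flip b (flip c x) = flip (b (+) c) x.
Proof. by case: b; case: c => //=; rewrite antiK. Qed.

Lemma flip_eq b c x : (flip b x == flip c x) = (b == c).
Proof.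
case: b; case: c; rewrite /= ?eqxx // ?(negPf (anti_neq _)) //.
by rewrite eq_sym (negPf (anti_neq _)).
Qed.

Lemma same_flipP x y : reflect (exists b, y = flip b x) (same x y).
Proof. by apply: (iffP existsP) => -[b /eqP]; exists b => //; apply/eqP. Qed.

Lemma same_refl x : same x x.
Proof. by apply/same_flipP; exists false. Qed.

Lemma same_sym x y : same x y = same y x.
Proof.
by apply/same_flipP/same_flipP => -[b ->]; exists b; rewrite flipK.
Qed.

Lemma same_trans y x z : same x y -> same y z -> same x z.
Proof.
move=> /same_flipP[b ->] /same_flipP[c ->]; apply/same_flipP; exists (c (+) b).
by rewrite flip_add.
Qed.

Lemma same_flipr b x y : same x (flip b y) = same x y.
Proof.
apply/idP/idP => h; apply: (same_trans h); apply/same_flipP; exists b => //.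
by rewrite flipK.
Qed.

Lemma same_flipl b x y : same (flip b x) y = same x y.
Proof. by rewrite same_sym same_flipr same_sym. Qed.

Lemma edge_same x y a : edge x y a -> ~~ same x y.
Proof.
move=> /edge_neq/andP[h1 h2]; apply/negP => /same_flipP[[|] /= e].
  by rewrite e eqxx in h2.
by rewrite e eqxx in h1.
Qed.

Lemma flK b a : a <= delta -> fl b (fl b a) = a.
Proof. by case: b => //= h; rewrite subKn. Qed.

Lemma fl_add b c a : a <= delta -> fl b (fl c a) = fl (b (+) c) a.
Proof. by move=> h; case: b; case: c => //=; rewrite subKn. Qed.

Lemma edge_le x y a : edge x y a -> a <= delta.
Proof. by move/edge_range; lia. Qed.

Lemma edge_flip b c x y a :
  edge x y a -> edge (flip b x) (flip c y) (fl (b (+) c) a).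
Proof.
move=> h; have hl := edge_le h.
have h1 : edge (flip b x) y (fl b a) by case: (b) => //=; apply: edge_anti.
rewrite addbC -fl_add //; case: (c) => //=.
by apply: edge_sym; apply: edge_anti; apply: edge_sym.
Qed.

(** The number [k] of steps is kept apart from the length [n]: bad walks are defined by their length
    but killed by induction on their steps. *)
Fixpoint walk k x y n : bool :=
  if k is k'.+1 then
    [exists z, [exists a : 'I_n.+1, edge x z a && walk k' z y (n - a)]]
  else (x == y) && (n == 0).

Lemma walk0 x : walk 0 x x 0.
Proof. by rewrite /= !eqxx. Qed.

Lemma walk_cons x z y a k n : edge x z a -> walk k z y n ->
  walk k.+1 x y (a + n).
Proof.
move=> e w; apply/existsP; exists z.
have ha : a < (a + n).+1 by rewrite ltnS leq_addr.
by apply/existsP; exists (Ordinal ha); rewrite e addKn.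
Qed.

Lemma walkSP k x y n : walk k.+1 x y n ->
  exists z a m, [/\ edge x z a, walk k z y m & n = a + m].
Proof.
move=> /existsP[z /existsP[a /andP[e w]]]; exists z, a, (n - a).
by split=> //; rewrite subnKC // -ltnS ltn_ord.
Qed.

Lemma walk1 x y a : edge x y a -> walk 1 x y a.
Proof. by move=> e; rewrite -[a]addn0; apply: walk_cons e (walk0 _). Qed.

Lemma walk_cat k l x y z m n : walk k x y m -> walk l y z n ->
  walk (k + l) x z (m + n).
Proof.
elim: k x m => [|k IH] x m; first by move=> /= /andP[/eqP-> /eqP->].
move=> /walkSP[u [a [m' [e w ->]]]] w'; rewrite addSn -addnA.
by apply: walk_cons e (IH _ _ w w').
Qed.

Lemma walk_flip b k x y n : walk k x y n -> walk k (flip b x) (flip b y) n.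
Proof.
elim: k x n => [|k IH] x n; first by move=> /= /andP[/eqP-> ->]; rewrite eqxx.
move=> /walkSP[u [a [m' [e w ->]]]].
apply: walk_cons (IH _ _ w).
by move/(edge_flip b b): e; rewrite addbb.
Qed.

Lemma walk_sym k x y n : walk k x y n -> walk k y x n.
Proof.
elim: k x n => [|k IH] x n; first by rewrite /= eq_sym.
move=> /walkSP[u [a [m [e w ->]]]].
by rewrite addnC -addn1; apply: walk_cat (IH _ _ w) (walk1 (edge_sym e)).
Qed.

Lemma walk_leq k x y n : walk k x y n -> k <= n.
Proof.
elim: k x n => [|k IH] x n // /walkSP[u [a [m [e /IH w ->]]]].
by have := edge_range e; lia.
Qed.

Lemma walk_parity : bip -> forall k x y n,
  walk k x y n -> odd n = odd (target x y).
Proof.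
move=> hb; elim=> [|k IH] x y n.
  move=> /= /andP[/eqP-> /eqP->].
  by have := target_parity hb y y y; case: (odd (target y y)).
move=> /walkSP[u [a [m [e /IH w ->]]]].
by rewrite oddD (edge_parity hb e) w target_parity.
Qed.

(* In a space of the class a walk from a point to its antipode has length at *)
(* least [delta], and a closed walk of odd length has length at least [2K].  *)
Definition bad x y n :=
  ((y == anti x) && (n < delta)) || [&& y == x, odd n & n < 2 * K].

Definition unbad k := forall j x y n, j < k -> walk j x y n -> ~~ bad x y n.

Hypothesis hK : K <= delta.

Lemma bad_same x y n : bad x y n -> same x y.
Proof.
by move=> /orP[/andP[/eqP-> _]|/and3P[/eqP-> _ _]]; apply/same_flipP;
  [exists true|exists false].
Qed.

(** Start of the induction: an edge never joins a point to itself or to its antipode. *)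
Lemma unbad2 : unbad 2.
Proof.
move=> [|[|//]] x y n _ w; apply/negP => hb.
  move: w hb => /= /andP[/eqP-> /eqP->].
  by rewrite /bad [y == anti y]eq_sym (negPf (anti_neq y)) /= andbF.
have [z [a [m [e /andP[/eqP ezy _] _]]]] := walkSP w.
by have := edge_same e; rewrite ezy (bad_same hb).
Qed.

Lemma badE b x n : bad x (flip b x) n =
  if b then n < delta else odd n && (n < 2 * K).
Proof.
rewrite /bad -[anti x]/(flip true x) -{4}[x]/(flip false x) !flip_eq.
by case: b; rewrite //= orbF.
Qed.

(** Excising the middle segment leaves two closed walks, up to antipodes, whose lengths add up. If
    the sum is odd and below [2K], one length is odd, and one is below [delta] since [K <= delta]; a
    sum below [delta] makes both short. *)
Lemma bad_split b x y u m1 m2 m3 : bad x y (m1 + m2 + m3) ->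
  bad u (flip b u) m2 || bad x (flip b y) (m1 + m3).
Proof.
move=> h; have /same_flipP[c e] := bad_same h; move: h; rewrite e flip_add !badE.
by case: b; case: c {e} => /=; lia.
Qed.

(** If [e] exceeds [m2], closing the middle arc with [delta - e] reaches the antipode of [u] in
    length below [delta]. Otherwise [e] replaces the middle arc without lengthening the walk, which
    settles the antipodal case; in the odd case the outer arc is treated symmetrically, and parity
    decides when [e] exceeds neither arc. *)
Lemma bad_chord x y u m1 m2 m3 e : 0 < e < delta -> bad x y (m1 + m2 + m3) ->
  (exists b, bad u (flip b u) (m2 + fl b e)) \/
  (exists b, bad x (flip b y) (m1 + fl b e + m3)).
Proof.
move=> he h; have /same_flipP[c ey] := bad_same h; move: h; rewrite ey badE => h.
have : [|| bad u (flip false u) (m2 + fl false e),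
  bad u (flip true u) (m2 + fl true e),
  bad x (flip false (flip c x)) (m1 + fl false e + m3) |
  bad x (flip true (flip c x)) (m1 + fl true e + m3)].
  by rewrite !flip_add !badE /fl; case: c h {ey} => /=; lia.
by case/or4P => h'; [left; exists false|left; exists true|
  right; exists false|right; exists true].
Qed.

(** The arc cut off by the chord closes up in [r.+1 < k] steps, so it is not bad and the badness
    passes to the rest. *)
Lemma chord k p r s x u v y m1 m2 m3 e : unbad k -> r.+1 < k ->
  walk p x u m1 -> walk r u v m2 -> walk s v y m3 -> edge u v e ->
  bad x y (m1 + m2 + m3) -> exists b, bad x (flip b y) (m1 + fl b e + m3).
Proof.
move=> hu hr wp wr ws he hb.
case: (bad_chord u (edge_range he) hb) => // -[b hb'].
have w' : walk (r + 1) u (flip b u) (m2 + fl b e).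
  apply: (walk_cat wr); apply: walk1.
  by move/edge_sym/(@edge_flip false b): he.
by have := hu _ _ _ _ _ w'; rewrite addn1 hb' => /(_ hr).
Qed.

Lemma walk_seq k x y n : walk k x y n -> exists (f : nat -> V) (l : nat -> nat),
  [/\ f 0 = x, f k = y, forall i, i < k -> edge (f i) (f i.+1) (l i) &
      n = \sum_(0 <= i < k) l i].
Proof.
elim: k x n => [|k IH] x n.
  by move=> /= /andP[/eqP-> /eqP->]; exists (fun=> y), (fun=> 0); rewrite big_geq.
move=> /walkSP[z [a [m [e /IH[f [l [f0 fk fe ->]]] ->]]]].
exists (fun i => if i is i'.+1 then f i' else x).
exists (fun i => if i is i'.+1 then l i' else a).
split=> //; first by case=> [|i] /= hi; rewrite ?f0 // fe.
by rewrite big_nat_recl.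
Qed.

End Walks.

(** * Bad cycles *)

Section Cycles.
Variables (V : system) (k : nat).
Hypotheses (hK : K <= delta) (k_gt1 : 1 < k) (unbad_k : unbad V k).

(** A finite type, because a point of the cover will carry one bit for each of its elements. *)
Definition cycle_data := {ffun 'I_k.+1 -> V * 'I_delta.+1}.
Implicit Types (w : cycle_data) (x y : V) (b c : bool) (a i j : nat).

Definition vx w i : V := (w (inord i)).1.
Definition lb w i : nat := (w (inord i)).2.

Definition bad_cycle w :=
  [forall i : 'I_k, edge (vx w i) (vx w i.+1) (lb w i)] &&
  bad (vx w 0) (vx w k) (\sum_(0 <= i < k) lb w i).

Definition on w x := [exists i : 'I_k.+1, same (vx w i) x].

(** All antipodal variants of the first edge are identified; along them the sheet of the cover
    changes. *)
Definition first_dir w x y a := [exists b, [exists c,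
  [&& x == flip b (vx w 0), y == flip c (vx w 1) & a == fl (b (+) c) (lb w 0)]]].

Definition first w x y a := first_dir w x y a || first_dir w y x a.

Lemma onP w x : reflect (exists2 i, i <= k & same (vx w i) x) (on w x).
Proof.
apply: (iffP existsP) => [[i h]|[i hi h]]; first by exists i; rewrite // -ltnS.
by have hi' : i < k.+1 by []; exists (Ordinal hi').
Qed.

Lemma lb_le w i : lb w i <= delta.
Proof. by rewrite -ltnS ltn_ord. Qed.

Lemma first_dirP w x y a : reflect (exists b c,
    [/\ x = flip b (vx w 0), y = flip c (vx w 1) & a = fl (b (+) c) (lb w 0)])
  (first_dir w x y a).
Proof.
apply: (iffP existsP) => [[b /existsP[c /and3P[/eqP-> /eqP-> /eqP->]]]|].
  by exists b, c.
by move=> [b [c [-> -> ->]]]; exists b; apply/existsP; exists c; rewrite !eqxx.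
Qed.

Lemma first_sym w x y a : first w x y a = first w y x a.
Proof. by rewrite /first orbC. Qed.

Lemma first_dir_flip b c w x y a : first_dir w x y a ->
  first_dir w (flip b x) (flip c y) (fl (b (+) c) a).
Proof.
move=> /first_dirP[b' [c' [-> -> ->]]]; apply/first_dirP; exists (b (+) b'), (c (+) c').
by rewrite !flip_add fl_add ?lb_le // addbACA.
Qed.

Lemma first_flip b c w x y a : first w x y a ->
  first w (flip b x) (flip c y) (fl (b (+) c) a).
Proof.
case/orP => h; apply/orP; [left|right]; first exact: first_dir_flip.
by rewrite addbC; apply: first_dir_flip.
Qed.

Lemma cycle_edge w i : bad_cycle w -> i < k -> edge (vx w i) (vx w i.+1) (lb w i).
Proof. by move=> /andP[/forallP h _] hi; apply: (h (Ordinal hi)). Qed.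

Lemma cycle_walk w i j : bad_cycle w -> i <= j <= k ->
  walk (j - i) (vx w i) (vx w j) (\sum_(i <= m < j) lb w m).
Proof.
move=> hw; elim: j => [|j IH] /andP[hij hj].
  by move: hij; rewrite leqn0 => /eqP->; rewrite subnn big_geq ?walk0.
move: hij; rewrite leq_eqVlt => /orP[/eqP->|hij].
  by rewrite subnn big_geq ?walk0.
rewrite subSn // big_nat_recr // -addn1.
by apply: walk_cat (IH _) (walk1 (cycle_edge hw hj)); rewrite -ltnS hij ltnW.
Qed.

Lemma cycle_bad w i j : bad_cycle w -> i <= j <= k ->
  bad (vx w 0) (vx w k) (\sum_(0 <= m < i) lb w m + \sum_(i <= m < j) lb w m
    + \sum_(j <= m < k) lb w m).
Proof.
move=> /andP[_ h] /andP[hij hj].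
by rewrite -!big_cat_nat //= ?(leq_trans hij).
Qed.

Lemma cycle_end w : bad_cycle w -> same (vx w 0) (vx w k).
Proof. by move=> /andP[_ /bad_same]. Qed.

(** A coincidence would split the cycle, by [bad_split], into two closed walks with fewer than [k]
    steps, one of them bad. *)
Lemma cycle_distinct w i j : bad_cycle w -> i < j <= k -> j - i < k ->
  ~~ same (vx w i) (vx w j).
Proof.
move=> hw /andP[hij hj] hk; apply/negP => /same_flipP[b e].
have h1 : 0 <= i <= k by lia.
have h2 : i <= j <= k by lia.
have h3 : j <= k <= k by lia.
have w1 := cycle_walk hw h1; have w2 := cycle_walk hw h2.
have w3 := walk_flip b (cycle_walk hw h3).
case/orP: (bad_split hK b (vx w i) (cycle_bad hw h2)) => hb.
  by move: w2; rewrite e => /(unbad_k hk); rewrite hb.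
rewrite e flipK in w3.
by move: (walk_cat w1 w3) => /unbad_k; rewrite hb => /(_ ltac:(lia)).
Qed.

Lemma cycle_first w : bad_cycle w -> first w (vx w 0) (vx w 1) (lb w 0).
Proof.
by move=> hw; apply/orP; left; apply/first_dirP; exists false, false.
Qed.

Lemma cycle_firstN w i : bad_cycle w -> 0 < i < k ->
  ~~ first w (vx w i) (vx w i.+1) (lb w i).
Proof.
move=> hw /andP[hi0 hik]; apply/negP => /orP[] /first_dirP[b [c [e1 e2 e3]]].
  suff : ~~ same (vx w 0) (vx w i) by rewrite e1 same_flipr same_refl.
  by apply: cycle_distinct => //; lia.
have hi : i.+1 = k.
  apply/eqP; apply: contraT => hne.
  suff : ~~ same (vx w 0) (vx w i.+1) by rewrite e1 same_flipr same_refl.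
  by apply: cycle_distinct => //; lia.
have hi1 : i = 1.
  apply/eqP; apply: contraT => hne.
  suff : ~~ same (vx w 1) (vx w i) by rewrite e2 same_flipr same_refl.
  by apply: cycle_distinct => //; lia.
(* The cycle now runs back along its first edge, up to antipodes: its length is [2 * lb w 0] or
   exactly [delta], and neither is bad. *)
subst i.
have c0 : c = false.
  apply/eqP; move/eqP: e2.
  by rewrite -{1}[vx w 1]/(flip false (vx w 1)) flip_eq eq_sym.
move: hw => /andP[_]; rewrite -hi e1 badE // big_nat_recr //= big_nat1.
rewrite e3 c0 addbF; have := lb_le w 0.
by case: (b) => /=; lia.
Qed.

(** The two chords successively cut off closed walks with [j] and [k - j + 1] steps, both fewer than
    [k], so the triangle left on the first edge is bad. *)
Lemma cycle_triangle w j a1 a2 : bad_cycle w -> 1 < j < k ->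
  edge (vx w 1) (vx w j) a1 -> edge (vx w j) (vx w 0) a2 ->
  exists b1 b2, bad (vx w 0) (flip (b1 (+) b2) (vx w 0))
    (lb w 0 + fl b1 a1 + fl b2 a2).
Proof.
move=> hw /andP[hj hjk] e1 e2.
have h1 : 0 <= 1 <= k by lia.
have h2 : 1 <= j <= k by lia.
have h3 : j <= k <= k by lia.
have w1 := cycle_walk hw h1; have w2 := cycle_walk hw h2.
have w3 := cycle_walk hw h3.
have [|b1] := chord hK unbad_k _ w1 w2 w3 e1 (cycle_bad hw h2); first by lia.
rewrite big_nat1 => hb1.
have w1' : walk (1 + 1) (vx w 0) (flip b1 (vx w j)) (lb w 0 + fl b1 a1).
  rewrite big_nat1 in w1; apply: walk_cat w1 (walk1 _).
  exact: (@edge_flip V false b1).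
have w3' := walk_flip b1 w3.
have /same_flipP[c ek] : same (vx w 0) (vx w k) by apply: cycle_end.
have e2' : edge (flip b1 (vx w j)) (flip b1 (vx w k)) (fl c a2).
  rewrite ek flip_add.
  by have := edge_flip b1 (b1 (+) c) e2; rewrite addKb.
have [|| b2] := chord hK unbad_k _ w1' w3' (walk0 _) e2'; rewrite ?addn0 //.
  by clear - hj hjk; lia.
rewrite ek !flip_add fl_add ?(edge_le e2) // => hb.
exists b1, (b2 (+) c).
by rewrite (_ : b1 (+) (b2 (+) c) = b2 (+) b1 (+) c) // addbA (addbC b1).
Qed.

End Cycles.
End Antipodal.
Arguments same_flipP {delta K V x y}.
Arguments onP {delta K V k w x}.
Arguments first_dirP {delta K V k w x y a}.

(** * Covers *)

Section Unwinding.
Variables delta K : nat.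

Record automorphic (V : system delta K) (g : {perm V}) : Prop := Automorphic {
  aut_anti : forall x, g (anti x) = anti (g x);
  aut_edge : forall x y a, edge (g x) (g y) a = edge x y a;
  aut_target : forall x y, target (g x) (g y) = target x y
}.

(** Distinctness of the points is dropped, since degenerate triangles have even perimeter at most
    [2 * delta]. In the last field the minimum of the sides is reached by permuting the points. *)
Record admissible (A : finType) (d : A -> A -> nat) : Prop := Admissible {
  adm_eq0 : forall x y, (d x y == 0) = (x == y);
  adm_sym : forall x y, d x y = d y x;
  adm_tri : forall x y z, d x z <= d x y + d y z;
  adm_perim : forall x y z, d x y + d y z + d x z <= 2 * delta;
  adm_odd_ge : forall x y z, odd (d x y + d y z + d x z) ->
    2 * K <= d x y + d y z + d x z;
  adm_odd_le : forall x y z, odd (d x y + d y z + d x z) ->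
    d x y + d y z + d x z <= 2 * (delta - K) + 2 * d x y
}.

Variables (A : finType) (d : A -> A -> nat).
Hypothesis adm : admissible d.

(** The invariant kept from the initial system through all covers: distance [delta] is carried by
    the involution, intermediate distances by edges, and partial isometries of the copy extend. *)
Record embeds (V : system delta K) (e : A -> V) : Prop := Embeds {
  emb_anti : forall x y, d x y = delta -> e y = anti (e x);
  emb_edge : forall x y, 0 < d x y < delta -> edge (e x) (e y) (d x y);
  emb_ext : forall (D : {set A}) (p : A -> A),
    {in D &, forall x y, d (p x) (p y) = d x y} ->
    exists2 g : {perm V}, automorphic g & {in D, forall x, g (e x) = e (p x)}
}.

Lemma adm_le x y : d x y <= delta.
Proof.
have := adm_perim adm x y x; rewrite (adm_sym adm y x).
have /eqP -> : d x x == 0 by rewrite (adm_eq0 adm).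
by lia.
Qed.

(** The triangle inequality and the perimeter bound squeeze [d x z + d y z] to [delta]. *)
Lemma adm_antipode x y z : d x y = delta -> d y z = delta - d x z.
Proof.
move=> h; have := adm_perim adm x y z; have := adm_tri adm x z y.
by rewrite h (adm_sym adm z y); lia.
Qed.

Hypothesis hK : K <= delta.

(* Replacing points by their antipodes leaves the conditions invariant. *)
Lemma adm_not_bad (V : system delta K) (v : V) x y z b1 b2 b3 :
  ~~ bad v (flip (b1 (+) b2 (+) b3) v)
    (fl delta b1 (d x y) + fl delta b2 (d y z) + fl delta b3 (d z x)).
Proof.
rewrite badE //.
have := adm_le x y; have := adm_le y z; have := adm_le z x.
have := adm_tri adm x y z; have := adm_tri adm y z x; have := adm_tri adm z x y.
have := adm_perim adm x y z; have := @adm_odd_ge _ _ adm x y z.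
have := @adm_odd_le _ _ adm x y z; have := @adm_odd_le _ _ adm y z x.
have := @adm_odd_le _ _ adm z x y;
rewrite (adm_sym adm x z) (adm_sym adm y x) (adm_sym adm z y).
by case: b1; case: b2; case: b3 => /=; lia.
Qed.

Section Cover.
Variables (V : system delta K) (e : A -> V) (k : nat).
Hypotheses (k_gt1 : 1 < k) (unbad_k : unbad V k) (emb : embeds e).

Notation cycle_data := (cycle_data V k).
Implicit Types (w : cycle_data) (u v : V) (x y z : A).

Lemma emb_same x y : same (e x) (e y) = ~~ (0 < d x y < delta).
Proof.
apply/idP/idP => [h|]; first by apply: contraL h => /(emb_edge emb)/edge_same.
rewrite lt0n (adm_eq0 adm) negb_and negbK => /orP[/eqP->|h].
  exact: same_refl.
apply/same_flipP; exists true; apply: (emb_anti emb).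
by have := adm_le x y; lia.
Qed.

Lemma first_antipode w x y z : d y z = delta ->
  first w (e x) (e y) (d x y) -> first w (e x) (e z) (d x z).
Proof.
move=> h /(first_flip false true) /=.
by rewrite (emb_anti emb h) !(adm_sym adm x) (adm_antipode _ h).
Qed.

(** Otherwise [cycle_triangle] yields a bad triangle whose labels are distances of [x], [y], [z] up
    to flips, against [adm_not_bad]. *)
Lemma no_triangle_on_cycle w x y z j b c : bad_cycle w -> 1 < j < k ->
  e x = flip b (vx w 0) -> e y = flip c (vx w 1) -> same (vx w j) (e z) ->
  d x y = fl delta (b (+) c) (lb w 0) -> False.
Proof.
move=> hw hj ex ey /same_flipP[c' ez] hd.
have h0 : ~~ same (e z) (e x).
  rewrite ez ex same_flipl same_flipr same_sym.
  by apply: (cycle_distinct hK k_gt1 unbad_k) => //; lia.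
have h1 : ~~ same (e y) (e z).
  rewrite ez ey same_flipl same_flipr.
  by apply: (cycle_distinct hK k_gt1 unbad_k) => //; lia.
rewrite emb_same negbK in h0; rewrite emb_same negbK in h1.
have := edge_flip c c' (emb_edge emb h1); rewrite ey ez !flipK => e1.
have := edge_flip c' b (emb_edge emb h0); rewrite ex ez !flipK => e2.
have [b1 [b2]] := cycle_triangle hK k_gt1 unbad_k hw hj e1 e2.
have -> : lb w 0 = fl delta (b (+) c) (d x y) by rewrite hd flK ?lb_le.
rewrite !fl_add ?adm_le //.
have := adm_not_bad (vx w 0) x y z (b (+) c) (b1 (+) (c (+) c')) (b2 (+) (c' (+) b)).
rewrite (_ : _ (+) _ (+) _ = b1 (+) b2); first by move/negP.
by case: (b); case: (c); case: (c'); case: (b1); case: (b2).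
Qed.

(** The bit of [x] in the lifted copy: 1 only over the start of [w], and only if the space realizes
    the first edge there, so that the bit changes across that edge and no other. *)
Definition lift w x :=
  [&& bad_cycle w, same (vx w 0) (e x) & [exists y, first w (e x) (e y) (d x y)]].

Lemma vx01 w : bad_cycle w -> ~~ same (vx w 0) (vx w 1).
Proof. by move=> hw; apply: (cycle_distinct hK k_gt1 unbad_k) => //; lia. Qed.

(** Let [z] realize the first edge with [x]. A point [y] over vertex 1 is [z] or its antipode; over
    an inner vertex it would form a forbidden triangle with [x] and [z]; over an end of the cycle it
    would coincide with [x] up to antipodes. *)
Lemma lift_first w x y : on w (e y) -> 0 < d x y < delta -> lift w x ->
  first w (e x) (e y) (d x y).
Proof.
move=> /onP[j hj hjy] hd /and3P[hw h0 /existsP[z hz]].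
have h01 := vx01 hw.
case/orP: (hz) => /first_dirP[b [c [e1 e2 e3]]]; last first.
  by rewrite e2 same_flipr (negPf h01) in h0.
have hny : ~~ same (e x) (e y) by rewrite emb_same negbK.
have h0y : ~~ same (vx w 0) (e y) by rewrite e1 same_flipl in hny.
case: j hj hjy => [|[|j]] hj hjy; first by rewrite hjy in h0y.
  have : same (e z) (e y) by rewrite e2 same_flipl.
  rewrite emb_same.
  rewrite lt0n (adm_eq0 adm) negb_and negbK => /orP[/eqP<- //|h].
  by apply: first_antipode hz; have := adm_le z y; lia.
have [hjk|] := ltnP j.+2 k; first by case: (no_triangle_on_cycle hw _ e1 e2 hjy e3).
move=> hk; have {}hk : j.+2 = k by apply/eqP; rewrite eqn_leq hj.
rewrite hk in hjy.
by rewrite (same_trans (cycle_end hw) hjy) in h0y.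
Qed.

Lemma lift_edge w x y : bad_cycle w -> on w (e x) -> on w (e y) ->
  0 < d x y < delta -> lift w x (+) lift w y = first w (e x) (e y) (d x y).
Proof.
move=> hw ox oy hd.
have hdy : 0 < d y x < delta by rewrite (adm_sym adm).
have hn : ~~ (lift w x && lift w y).
  apply/negP => /andP[/and3P[_ h1 _] /and3P[_ h2 _]].
  have : ~~ same (e x) (e y) by rewrite emb_same negbK.
  by rewrite same_sym in h1; rewrite (same_trans h1 h2).
case: (boolP (first _ _ _ _)) => [|hf].
  move=> hf; have : lift w x || lift w y.
    case/orP: (hf) => /first_dirP[b [c [e1 e2 e3]]]; apply/orP; [left|right].
      rewrite /lift hw e1 same_flipr same_refl -e1 /=.
      by apply/existsP; exists y.
    rewrite /lift hw e1 same_flipr same_refl -e1 /=.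
    by apply/existsP; exists x; rewrite first_sym (adm_sym adm).
  by case: (lift w x) hn; case: (lift w y).
have /negPf-> : ~~ lift w x by apply: contra hf; apply: lift_first.
have /negPf-> // : ~~ lift w y.
by apply: contra hf => /(lift_first ox hdy); rewrite first_sym (adm_sym adm).
Qed.

Lemma lift_antipode w x y : d x y = delta -> lift w x = lift w y.
Proof.
wlog suff h : x y / d x y = delta -> lift w x -> lift w y.
  move=> hd; apply/idP/idP; first exact: h.
  by apply: h; rewrite (adm_sym adm).
move=> hd /and3P[hw h0 /existsP[z hz]]; apply/and3P; split=> //.
  by rewrite (emb_anti emb hd) (same_flipr true).
apply/existsP; exists z; rewrite first_sym (adm_sym adm y).
by apply: (first_antipode hd); rewrite first_sym (adm_sym adm z).
Qed.

(** The double covers of all cycles with [k] steps are taken at once, so that automorphisms, which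
    permute the cycles, can be lifted. *)
Definition cover_point : finType := (V * {ffun cycle_data -> bool})%type.
Implicit Types (X Y : cover_point).

Definition cover_anti X : cover_point := (anti X.1, X.2).

Definition cover_edge X Y a := edge X.1 Y.1 a && [forall w : cycle_data,
  [&& bad_cycle w, on w X.1 & on w Y.1] ==>
    (X.2 w (+) Y.2 w == first w X.1 Y.1 a)].

Lemma cover_edgeP X Y a : reflect (edge X.1 Y.1 a /\
    forall w : cycle_data, bad_cycle w -> on w X.1 -> on w Y.1 ->
    X.2 w (+) Y.2 w = first w X.1 Y.1 a)
  (cover_edge X Y a).
Proof.
apply: (iffP andP) => -[h1 h2]; split=> //.
  by move=> w h3 h4 h5; move/forallP/(_ w): h2; rewrite h3 h4 h5 => /eqP.
by apply/forallP => w; apply/implyP => /and3P[h3 h4 h5]; rewrite h2.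
Qed.

Lemma on_flip b w v : on w (flip b v) = on w v.
Proof.
by apply/onP/onP => -[i hi h]; exists i => //; rewrite same_flipr in h *.
Qed.

Fact cover_antiK : involutive cover_anti.
Proof. by case=> v chi; rewrite /cover_anti antiK. Qed.

Fact cover_anti_neq X : cover_anti X != X.
Proof. by case: X => v chi; rewrite xpair_eqE (negPf (anti_neq v)). Qed.

Fact cover_edge_sym X Y a : cover_edge X Y a -> cover_edge Y X a.
Proof.
move=> /cover_edgeP[h1 h2]; apply/cover_edgeP; split; first exact: edge_sym.
by move=> w h3 h4 h5; rewrite addbC first_sym; apply: h2.
Qed.

Fact cover_edge_anti X Y a :
  cover_edge X Y a -> cover_edge (cover_anti X) Y (delta - a).
Proof.
move=> /cover_edgeP[h1 h2]; apply/cover_edgeP; split; first exact: edge_anti.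
move=> w h3 /=; rewrite (on_flip true) => h4 h5; rewrite h2 //.
apply/idP/idP; first exact: (first_flip true false).
move/(first_flip true false) => /=.
by rewrite antiK subKn // (edge_le h1).
Qed.

Fact cover_edge_range X Y a : cover_edge X Y a -> 0 < a < delta.
Proof. by move=> /andP[/edge_range]. Qed.

Fact cover_edge_neq X Y a : cover_edge X Y a -> (Y != X) && (Y != cover_anti X).
Proof.
case: X Y => [u chi] [v psi] /andP[/edge_neq/andP[h1 h2] _].
by rewrite !xpair_eqE (negPf h1) (negPf h2).
Qed.

Definition cover : system delta K := System
  cover_antiK cover_anti_neq cover_edge_sym cover_edge_anti cover_edge_range
  cover_edge_neq
  (fun hb X Y a h => edge_parity hb (proj1 (cover_edgeP X Y a h)))
  (fun X Y => target_sym X.1 Y.1) (fun X Y => target_anti X.1 Y.1)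
  (fun X Y => target_le X.1 Y.1) (fun X Y => target_gt0 X.1 Y.1)
  (fun X Y => target_lb X.1 Y.1)
  (fun hb X Y Z => target_parity hb X.1 Y.1 Z.1).

Lemma cover_walk j (X Y : cover) n : walk j X Y n -> walk j X.1 Y.1 n.
Proof.
elim: j X n => [|j IH] X n; first by move=> /= /andP[/eqP-> ->]; rewrite eqxx.
by move=> /walkSP[Z [a [m [/andP[h _] /IH h' ->]]]]; apply: walk_cons h h'.
Qed.

Lemma cover_bad (X Y : cover) n : bad X Y n -> bad X.1 Y.1 n && (Y.2 == X.2).
Proof.
by rewrite /bad => /orP[/andP[/eqP-> ->]|/and3P[/eqP-> -> ->]];
  rewrite /= !eqxx ?orbT.
Qed.

(* Along a lift of a bad cycle [w] the [w]-coordinate changes exactly once, on *)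
(* the first edge, so the lift is not closed.                                  *)
Lemma unbad_cover : unbad cover k.+1.
Proof.
move=> j X Y n hj hw; apply/negP => hb.
have /andP[hb1 /eqP hb2] := cover_bad hb.
have [hjk|hjk] := ltnP j k.
  by have := unbad_k hjk (cover_walk hw); rewrite hb1.
have {hj hjk} ej : j = k by apply/eqP; rewrite eqn_leq hjk -ltnS hj.
subst j; have [f [l [f0 fk fe en]]] := walk_seq hw.
pose w : cycle_data := [ffun i : 'I_k.+1 => ((f i).1, inord (l i))].
have vxE i : i <= k -> vx w i = (f i).1 by move=> h; rewrite /vx ffunE /= inordK.
have lbE i : i < k -> lb w i = l i.
  move=> h; have hl := edge_le (fe i h).
  by rewrite /lb ffunE /= !inordK // ltnS ltnW.
have hbw : bad_cycle w.
  apply/andP; split.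
    apply/forallP => i; rewrite !vxE ?lbE // 1?ltnW //.
    by have /cover_edgeP[] := fe i (ltn_ord i).
  have sumE : \sum_(0 <= i < k) lb w i = n.
    by rewrite en; apply: eq_big_nat => i /andP[_ /lbE].
  by rewrite !vxE // f0 fk sumE.
have onf i : i <= k -> on w (f i).1.
  by move=> hi; apply/onP; exists i => //; rewrite vxE // same_refl.
have step i : i < k -> (f i).2 w (+) (f i.+1).2 w = (i == 0).
  move=> hi; have hi' := ltnW hi.
  have /cover_edgeP[_ /(_ w hbw)->] := fe i hi; rewrite ?onf //.
  rewrite -!vxE // -lbE //.
  case: i hi {hi'} => [|i] hi; first exact: cycle_first.
  by apply/negbTE; apply: (cycle_firstN hK k_gt1 unbad_k).
have tele : forall i, 0 < i <= k -> (f 0).2 w (+) (f i).2 w.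
  elim=> [|j IH] // /andP[_ hj]; case: j IH hj => [|j] IH hj; first by rewrite step.
  have := step _ hj; have := IH (ltnW hj).
  by case: ((f 0).2 w); case: ((f j.+1).2 w); case: ((f j.+2).2 w).
by have := tele k; rewrite leqnn (ltnW k_gt1) f0 fk hb2 addbb => /(_ isT).
Qed.

Definition cover_emb x : cover := (e x, [ffun w => lift w x]).

(** * Lifting automorphisms to the cover *)

Section Automorphism.
Variable g : {perm V}.
Hypothesis aut_g : automorphic g.

Definition act (h : {perm V}) w : cycle_data := [ffun i => (h (w i).1, (w i).2)].

Lemma actK w : act g (act g^-1%g w) = w.
Proof. by apply/ffunP => i; rewrite !ffunE /= permKV; case: (w i). Qed.

Lemma actKV w : act g^-1%g (act g w) = w.
Proof. by apply/ffunP => i; rewrite !ffunE /= permK; case: (w i). Qed.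

Lemma vx_act w i : vx (act g w) i = g (vx w i).
Proof. by rewrite /vx ffunE. Qed.

Lemma lb_act w i : lb (act g w) i = lb w i.
Proof. by rewrite /lb ffunE. Qed.

Lemma aut_flip b v : g (flip b v) = flip b (g v).
Proof. by case: b => //=; apply: aut_anti. Qed.

Lemma aut_same u v : same (g u) (g v) = same u v.
Proof.
by apply/same_flipP/same_flipP => -[b h]; exists b;
  [apply: (@perm_inj _ g); rewrite aut_flip|rewrite h aut_flip].
Qed.

Lemma on_act w v : on (act g w) (g v) = on w v.
Proof.
by apply/onP/onP => -[i hi h]; exists i => //; rewrite vx_act aut_same in h *.
Qed.

Lemma first_act w u v a : first (act g w) (g u) (g v) a = first w u v a.
Proof.
suff dir u' v' : first_dir (act g w) (g u') (g v') a = first_dir w u' v' a.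
  by rewrite /first !dir.
apply/first_dirP/first_dirP => -[b [c [h1 h2 h3]]]; exists b, c.
  rewrite !vx_act lb_act -!aut_flip in h1 h2 h3.
  by split=> //; apply: (@perm_inj _ g).
by rewrite !vx_act lb_act -!aut_flip -h1 -h2.
Qed.

Lemma bad_cycle_act w : bad_cycle (act g w) = bad_cycle w.
Proof.
rewrite /bad_cycle; congr (_ && _).
  by apply: eq_forallb => i; rewrite !vx_act lb_act aut_edge.
rewrite /bad !vx_act -(aut_anti aut_g) !(inj_eq perm_inj).
by under eq_bigr do rewrite lb_act.
Qed.

Variables (D : {set A}) (p : A -> A).
Hypotheses (p_iso : {in D &, forall x y, d (p x) (p y) = d x y})
  (g_ext : {in D, forall x, g (e x) = e (p x)}).

(** Carrying the bits along with the cycles lifts [g], but the result may disagree with the copy of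
    [p] on [D]; this is the error at [w]. *)
Definition discrepancy w x := lift w (p x) (+) lift (act g^-1%g w) x.

Definition correction w :=
  [exists x, [&& x \in D, on w (g (e x)) & discrepancy w x]].

(** By [lift_edge] both lifts change along the same edges, because [g] preserves [first]; antipodal
    points share their bits. *)
Lemma discrepancy_const w x y : x \in D -> y \in D ->
  on w (g (e x)) -> on w (g (e y)) -> discrepancy w x = discrepancy w y.
Proof.
move=> xD yD ox oy; rewrite /discrepancy.
have [hw|hw] := boolP (bad_cycle w); last first.
  have hw' : ~~ bad_cycle (act g^-1%g w) by rewrite -bad_cycle_act actK.
  by rewrite /lift (negPf hw) (negPf hw').
case: (posnP (d x y)) => [/eqP|h0]; first by rewrite (adm_eq0 adm) => /eqP->.
have := adm_le x y; rewrite leq_eqVlt => /orP[/eqP h|h].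
  by rewrite (lift_antipode _ h) (lift_antipode _ (x := p x) (y := p y)) // p_iso.
have hd : 0 < d x y < delta by rewrite h0.
have hdp : 0 < d (p x) (p y) < delta by rewrite p_iso.
have hw' : bad_cycle (act g^-1%g w) by rewrite -bad_cycle_act actK.
have ox' : on (act g^-1%g w) (e x) by rewrite -on_act actK.
have oy' : on (act g^-1%g w) (e y) by rewrite -on_act actK.
rewrite !g_ext // in ox oy.
have := lift_edge hw ox oy hdp; rewrite p_iso // -!g_ext //.
have -> : first w (g (e x)) (g (e y)) (d x y) =
  first (act g^-1%g w) (e x) (e y) (d x y) by rewrite -[in LHS](actK w) first_act.
rewrite -(lift_edge hw' ox' oy' hd).
by do 4 case: (lift _ _).
Qed.

Lemma correctionE w x : x \in D -> on w (g (e x)) ->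
  correction w = discrepancy w x.
Proof.
move=> xD ox; apply/existsP/idP => [[y /and3P[yD oy]]|h].
  by rewrite (discrepancy_const xD yD).
by exists x; rewrite xD ox.
Qed.

(** Adding one constant at all points over [w] preserves the sums in [cover_edge], which involve
    only pairs of points over [w]. *)
Definition cover_map (X : cover) : cover := (g X.1, [ffun w : cycle_data =>
  X.2 (act g^-1%g w) (+) (on w (g X.1) && correction w)]).

Lemma cover_map_inj : injective cover_map.
Proof.
case=> [u chi] [v psi] [/perm_inj <- /ffunP h]; congr (_, _).
apply/ffunP => w; have := h (act g w); rewrite !ffunE actKV.
exact: addIb.
Qed.

Lemma cover_map_aut : automorphic (perm cover_map_inj).
Proof.
split=> [X|X Y a|X Y]; rewrite !permE.
- rewrite /cover_map /= /cover_anti /= (aut_anti aut_g); congr (_, _).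
  by apply/ffunP => w; rewrite !ffunE (on_flip true).
- apply/cover_edgeP/cover_edgeP => /= -[h1 h2].
    split; first by rewrite -(aut_edge aut_g).
    move=> w hw oX oY; have := h2 (act g w).
    rewrite bad_cycle_act !on_act !ffunE !on_act first_act actKV => /(_ hw oX oY) <-.
    by rewrite oX oY; case: (X.2 w); case: (Y.2 w); case: (correction _).
  split; first by rewrite (aut_edge aut_g).
  move=> w; rewrite -(actK w); move: (act _ w) => {}w.
  rewrite bad_cycle_act !on_act !ffunE !on_act first_act actKV => hw oX oY.
  by rewrite -h2 // oX oY; case: (X.2 w); case: (Y.2 w); case: (correction _).
- exact: (aut_target aut_g).
Qed.

Lemma cover_map_ext x : x \in D -> perm cover_map_inj (cover_emb x) = cover_emb (p x).
Proof.
move=> xD; rewrite permE /cover_map /= g_ext //; congr (_, _).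
apply/ffunP => w; rewrite !ffunE -g_ext //.
have [o|o] := boolP (on w _).
  by rewrite (correctionE xD o) /discrepancy addbC -addbA addbb addbF.
(* Off the cycle both bits vanish, since a point with bit 1 lies over the start of the cycle. *)
have lift_on w' y : lift w' y -> on w' (e y).
  by move=> /and3P[_ h _]; apply/onP; exists 0.
have /negPf-> : ~~ lift w (p x) by apply: contra o => /lift_on; rewrite g_ext.
have /negPf-> // : ~~ lift (act g^-1%g w) x.
by apply: contra o => /lift_on; rewrite -on_act actK.
Qed.

End Automorphism.

Lemma cover_embeds : embeds cover_emb.
Proof.
split=> [x y h|x y h|D p p_iso].
- rewrite /cover_emb /= /cover_anti /= (emb_anti emb h); congr (_, _).
  by apply/ffunP => w; rewrite !ffunE (lift_antipode _ h).
- apply/cover_edgeP; split; first exact: (emb_edge emb).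
  by move=> w hw ox oy; rewrite !ffunE; apply: lift_edge.
- have [g aut_g g_ext] := emb_ext emb p_iso.
  exists (perm (cover_map_inj (g := g) (D := D) (p := p))).
    exact: cover_map_aut.
  by move=> x xD; apply: cover_map_ext.
Qed.

End Cover.

Lemma unwind (V : system delta K) (e : A -> V) m : embeds e ->
  exists (V' : system delta K) (e' : A -> V'), embeds e' /\ unbad V' m.
Proof.
move=> emb; elim: m => [|m [V' [e' [emb' h']]]]; first by exists V, e.
(* Walks of fewer than two steps are never bad, so covers are taken from [m = 2] on. *)
have [hm|hm] := ltnP 1 m; last first.
  by exists V, e; split=> // j x y n hj; apply: unbad2; apply: leq_trans hj _.
exists (cover V' m), (cover_emb e' m); split; first exact: cover_embeds.
exact: unbad_cover.
Qed.

End Unwinding.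

(** * Completion *)

Section Completion.
Variables delta K : nat.
Hypotheses (hK : K <= delta) (hbip : (K == delta) || (2 * K <= delta))
  (delta_gt0 : 0 < delta).
Variable V : system delta K.
Hypothesis unbad_walk : forall k (x y : V) n, walk k x y n -> ~~ bad x y n.
Implicit Types (x y z : V).

Definition reach x y n := [exists k : 'I_n.+1, walk k x y n].

(** Truncated at [delta], the value that [find] returns when no walk is shorter. *)
Definition wdist x y := find (reach x y) (iota 0 delta).

Lemma wdist_le x y : wdist x y <= delta.
Proof. by have := find_size (reach x y) (iota 0 delta); rewrite size_iota. Qed.

Lemma wdist_walk x y : wdist x y < delta -> exists k, walk k x y (wdist x y).
Proof.
move=> h; have hs : has (reach x y) (iota 0 delta).
  by rewrite has_find size_iota.
have := nth_find 0 hs; rewrite nth_iota // => /existsP[k hk].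
by exists k.
Qed.

Lemma wdist_min k x y n : walk k x y n -> wdist x y <= n.
Proof.
move=> w; rewrite leqNgt; apply/negP => h.
have hn : n < delta := leq_trans h (wdist_le x y).
have := before_find 0 h; rewrite nth_iota // add0n => /existsP[].
have hk : k < n.+1 by rewrite ltnS (walk_leq w).
by exists (Ordinal hk).
Qed.

Lemma wdistxx x : wdist x x = 0.
Proof. by apply/eqP; rewrite -leqn0; apply: wdist_min (walk0 x). Qed.

Lemma wdist_eq0 x y : wdist x y = 0 -> x = y.
Proof.
move=> h; have [|k] := @wdist_walk x y; first by rewrite h.
by rewrite h => w; have := walk_leq w; case: k w => //= /andP[/eqP].
Qed.

Lemma wdist_tri x y z : wdist x z <= wdist x y + wdist y z.
Proof.
have [h1|h1] := ltnP (wdist x y) delta; last first.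
  by apply: leq_trans (wdist_le x z) (leq_trans h1 (leq_addr _ _)).
have [h2|h2] := ltnP (wdist y z) delta; last first.
  by apply: leq_trans (wdist_le x z) (leq_trans h2 (leq_addl _ _)).
have [k w] := wdist_walk h1; have [l w'] := wdist_walk h2.
exact: wdist_min (walk_cat w w').
Qed.

Lemma wdist_sym x y : wdist x y = wdist y x.
Proof.
suff h u v : wdist u v <= wdist v u by apply/eqP; rewrite eqn_leq !h.
have [/wdist_walk[k w]|h] := ltnP (wdist v u) delta.
  exact: wdist_min (walk_sym w).
exact: leq_trans (wdist_le u v) h.
Qed.

Lemma wdist_anti x y : wdist (anti x) y = wdist x (anti y).
Proof.
have h u v : wdist (anti u) (anti v) <= wdist u v.
  have [/wdist_walk[k w]|h] := ltnP (wdist u v) delta.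
    exact: wdist_min (walk_flip true w).
  exact: leq_trans (wdist_le _ _) h.
have := h x (anti y); have := h (anti x) y; rewrite !antiK => h1 h2.
by apply/eqP; rewrite eqn_leq h1 h2.
Qed.

Lemma wdist_antipode x : wdist x (anti x) = delta.
Proof.
apply/eqP; rewrite eqn_leq wdist_le leqNgt; apply/negP => h.
have [k /unbad_walk] := wdist_walk h.
by rewrite (badE true) h.
Qed.

Lemma wdist_parity x y : K = delta -> wdist x y < delta ->
  odd (wdist x y) = odd (target x y).
Proof.
by move=> /eqP hb /wdist_walk[k w]; apply: walk_parity w.
Qed.

(* The target is clamped to the interval allowed by the walks to [y] from [x] *)
(* and from the antipode of [x].                                              *)
Definition dist x y :=
  maxn (delta - wdist (anti x) y) (minn (target x y) (wdist x y)).

(** The clamping interval is nonempty: the two walks compose to one from a point to its antipode. *)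
Lemma wdist_anti_ge x y : delta <= wdist x y + wdist (anti x) y.
Proof.
by have := wdist_tri x y (anti x); rewrite wdist_antipode (wdist_sym y).
Qed.

Lemma dist_sym x y : dist x y = dist y x.
Proof. by rewrite /dist target_sym wdist_anti !(wdist_sym x). Qed.

Lemma dist_anti x y : dist (anti x) y = delta - dist x y.
Proof.
rewrite /dist antiK target_anti.
have := wdist_anti_ge x y; have := target_le x y.
have := wdist_le x y; have := wdist_le (anti x) y.
by lia.
Qed.

Lemma dist_le x y : dist x y <= delta.
Proof. by rewrite /dist; have := wdist_le x y; lia. Qed.

Lemma distxx x : dist x x = 0.
Proof. by rewrite /dist wdistxx wdist_sym wdist_antipode; lia. Qed.

Lemma dist_eq0 x y : dist x y = 0 -> x = y.
Proof.
move=> h; apply: wdist_eq0; move: h; rewrite /dist.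
by have := target_gt0 x y; lia.
Qed.

Lemma dist_ge_wdist x y : delta <= dist x y + wdist (anti x) y.
Proof. by rewrite /dist; lia. Qed.

Lemma dist_cases x y : dist x y = wdist x y \/ target x y <= dist x y.
Proof.
by rewrite /dist; have := wdist_anti_ge x y; lia.
Qed.

Lemma dist_parity x y : K = delta -> odd (dist x y) = odd (target x y).
Proof.
move=> hb; have := @wdist_parity x y hb; have := @wdist_parity (anti x) y hb.
rewrite target_anti /dist; have := wdist_anti_ge x y; have := target_le x y.
have := wdist_le x y; have := wdist_le (anti x) y.
move: (wdist x y) (wdist _ _) (target x y) => u u' t.
by clear; lia.
Qed.

Lemma dist_parity_add x y z : K = delta ->
  odd (dist x y) (+) odd (dist y z) = odd (dist x z).
Proof. by move=> hb; rewrite !dist_parity // target_parity // hb. Qed.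

Lemma dist_anti2 x y : dist (anti x) (anti y) = dist x y.
Proof. by rewrite dist_anti dist_sym dist_anti dist_sym subKn // dist_le. Qed.

Lemma wdist_anti2 x y : wdist (anti x) (anti y) = wdist x y.
Proof. by rewrite wdist_anti antiK. Qed.

Lemma target_anti2 x y : target (anti x) (anti y) = target x y.
Proof.
by rewrite target_anti target_sym target_anti target_sym subKn // target_le.
Qed.

(** The lower clamp bounds the third term from below by [delta - wdist z x]. *)
Lemma hexagon_wdist x y z : dist x y = wdist x y -> dist y z = wdist y z ->
  delta <= dist x y + dist y z + dist z (anti x).
Proof.
move=> -> ->; have := dist_ge_wdist z (anti x); have := wdist_tri x y z.
by rewrite wdist_anti2 (wdist_sym z); lia.
Qed.

(** Two targets fall short of [delta] by at most one, or two in the bipartite case; a positive third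
    term supplies one and parity the rest. A zero third term gives [z = anti x], where the sum is
    exactly [delta]. *)
Lemma hexagon_target x y z : target x y <= dist x y -> target y z <= dist y z ->
  delta <= dist x y + dist y z + dist z (anti x).
Proof.
move=> h1 h2; have [/dist_eq0 ->|h0] := posnP (dist z (anti x)).
  rewrite distxx addn0 (dist_sym y) dist_anti; have := dist_le x y; lia.
have := target_lb x y; have := target_lb y z.
have hp : K = delta ->
    odd (dist x y + dist y z + dist z (anti x)) = odd delta.
  move=> hb; rewrite !oddD !dist_parity_add // (dist_sym x) dist_anti distxx.
  by rewrite subn0.
case: eqP hp => [hb /(_ hb)|_ _] /=; lia.
Qed.

(* Equivalent to all the triangle inequalities on the points [x], [y], [z] and *)
(* their antipodes. Two of the three distances are of the same kind.           *)
Lemma hexagon x y z : delta <= dist x y + dist y z + dist z (anti x).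
Proof.
(* Opposite sides of the hexagon [x, y, z, anti x, anti y, anti z] are equal, so the three terms may
   be rotated. *)
have rot u v w : delta <= dist v w + dist w (anti u) + dist (anti u) (anti v) ->
    delta <= dist u v + dist v w + dist w (anti u).
  by rewrite dist_anti2; lia.
have [h1|h1] := dist_cases x y; have [h2|h2] := dist_cases y z;
  have [h3|h3] := dist_cases z (anti x).
- exact: hexagon_wdist.
- exact: hexagon_wdist.
- by apply: (rot); apply: rot; apply: hexagon_wdist; rewrite ?dist_anti2 ?wdist_anti2.
- by apply: rot; apply: hexagon_target.
- by apply: rot; apply: hexagon_wdist.
- by apply: (rot); apply: rot; apply: hexagon_target; rewrite ?dist_anti2 ?target_anti2.
- exact: hexagon_target.
- exact: hexagon_target.
Qed.

Lemma dist_tri x y z : dist x z <= dist x y + dist y z.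
Proof.
have := hexagon x y z; rewrite (dist_sym z) dist_anti; have := dist_le x z; lia.
Qed.

(** Outside the bipartite case, an odd perimeter exceeds twice each side, so one side at or above
    its target makes it at least [delta]. If all three sides are walk lengths, a smaller perimeter
    would give a bad closed walk. *)
Lemma dist_odd_ge x y z : odd (dist x y + dist y z + dist x z) ->
  2 * K <= dist x y + dist y z + dist x z.
Proof.
have [hb|hb] := eqVneq K delta.
  by rewrite !oddD dist_parity_add // addbb.
have hK2 : 2 * K <= delta by move: hbip; rewrite (negPf hb).
have hlb u v : target u v <= dist u v -> delta <= (2 * dist u v).+1.
  by have := target_lb u v; rewrite (negPf hb) /=; lia.
have := dist_tri x y z; have := dist_tri y z x; have := dist_tri z x y.
rewrite (dist_sym z y) (dist_sym y x) (dist_sym z x).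
have [h1|/hlb] := dist_cases x y; last by lia.
have [h2|/hlb] := dist_cases y z; last by lia.
have [h3|/hlb] := dist_cases x z; last by lia.
move=> _ _ _ ho; rewrite leqNgt; apply/negP => hlt.
have [k1 w1] : exists k, walk k x y (wdist x y) by apply: wdist_walk; lia.
have [k2 w2] : exists k, walk k y z (wdist y z) by apply: wdist_walk; lia.
have [k3 w3] : exists k, walk k x z (wdist x z) by apply: wdist_walk; lia.
have := unbad_walk (walk_cat (walk_cat w1 w2) (walk_sym w3)).
by rewrite (badE false) -h1 -h2 -h3 ho hlt.
Qed.

(** Replacing one point by its antipode turns the triangle inequality into the perimeter bound, and
    the lower bound on odd perimeters into the upper one. *)
Lemma dist_admissible : admissible delta K dist.
Proof.
split; first by move=> x y; apply/eqP/eqP => [/dist_eq0|->]; rewrite ?distxx.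
- exact: dist_sym.
- exact: dist_tri.
- move=> x y z; have := dist_tri x (anti y) z.
  rewrite (dist_sym x (anti y)) !dist_anti (dist_sym y x).
  by have := dist_le x y; have := dist_le y z; lia.
- exact: dist_odd_ge.
- move=> x y z; have := @dist_odd_ge x y (anti z).
  rewrite (dist_sym y (anti z)) (dist_sym x (anti z)) !dist_anti.
  rewrite (dist_sym z y) (dist_sym z x).
  by have := dist_le y z; have := dist_le x z; lia.
Qed.

Lemma walk_aut (g : {perm V}) : automorphic g ->
  forall k x y n, walk k (g x) (g y) n = walk k x y n.
Proof.
move=> aut_g; elim=> [|k IH] x y n /=; first by rewrite (inj_eq perm_inj).
apply/existsP/existsP => -[z /existsP[a h]].
  exists (g^-1%g z); apply/existsP; exists a.
  by rewrite -(aut_edge aut_g) -IH permKV.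
by exists (g z); apply/existsP; exists a; rewrite (aut_edge aut_g) IH.
Qed.

Lemma dist_aut (g : {perm V}) : automorphic g ->
  forall x y, dist (g x) (g y) = dist x y.
Proof.
move=> aut_g x y; rewrite /dist -(aut_anti aut_g) (aut_target aut_g).
have wE u v : wdist (g u) (g v) = wdist u v.
  by apply: eq_find => n; apply: eq_existsb => k; rewrite walk_aut.
by rewrite !wE.
Qed.

(** An edge and its antipodal form shrink the clamping interval to the label. *)
Lemma dist_emb (A : finType) (d : A -> A -> nat) (e : A -> V) :
  admissible delta K d -> embeds d e -> forall x y : A, dist (e x) (e y) = d x y.
Proof.
move=> adm emb x y; have [h0|h0] := posnP (d x y).
  have /eqP <- : x == y by rewrite -(adm_eq0 adm) h0.
  by rewrite distxx; apply/esym/eqP; rewrite (adm_eq0 adm).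
have := adm_le adm x y; rewrite leq_eqVlt => /orP[/eqP h|h].
  by rewrite (emb_anti emb h) dist_sym dist_anti distxx subn0.
have exy : edge (e x) (e y) (d x y) by apply: (emb_edge emb); rewrite h0.
have := wdist_min (walk1 exy); have := wdist_min (walk1 (edge_anti exy)).
by rewrite /dist; have := wdist_anti_ge (e x) (e y); lia.
Qed.

End Completion.

(** * Passing between relational structures and distance functions *)

Section Classes.
Variables delta K : nat.

Definition metric_structure (T : finType) (d : T -> T -> nat) : structure 'I_delta :=
  Structure (fun (i : 'I_delta) (x y : T) => d x y == i.+1).

Lemma admissible_class (T : finType) (d : T -> T -> nat) :
  admissible delta K d -> antipodal_class delta K (metric_structure d).
Proof.
move=> adm; exists d; split; first split.
- split=> [x y|x y|x y z]; last exact: (adm_tri adm).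
    by split=> /eqP h; apply/eqP; move: h; rewrite (adm_eq0 adm).
  exact: (adm_sym adm).
- by move=> x y; apply: (adm_le adm).
- by [].
move=> x y z _ _ _ [].
- by rewrite ltnNge (adm_perim adm).
- by move=> [/(adm_odd_ge adm)]; rewrite leqNgt => /negP.
move=> [ho]; apply/negP; rewrite -leqNgt.
have hs u v w : odd (d u v + d v w + d u w) ->
    d u v + d v w + d u w <= 2 * (delta - K) + 2 * d u v.
  exact: adm_odd_le.
have := hs x y z; have := hs y z x; have := hs z x y; move: ho.
rewrite (adm_sym adm y x) (adm_sym adm z x) (adm_sym adm z y).
by move: (d x y) (d y z) (d x z) => a b c; clear; lia.
Qed.

Lemma class_admissible (A : structure 'I_delta) : antipodal_class delta K A ->
  exists2 d : A -> A -> nat, admissible delta K d & represents_metric d.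
Proof.
move=> [d [hr ht]]; exists d => //; case: hr => -[h0 hs htri] hle _.
have d0 x : d x x = 0 by apply/h0.
have tri x y z : [\/ odd (d x y + d y z + d x z) = false /\
    d x y + d y z + d x z <= 2 * delta |
    ~ forbidden_triangle delta K (d x y) (d y z) (d x z)].
  have [->|/eqP nxy] := eqVneq x y.
    by left; rewrite d0; have := hle y z; lia.
  have [->|/eqP nyz] := eqVneq y z.
    by left; rewrite d0; have := hle x z; lia.
  have [->|/eqP nxz] := eqVneq x z.
    by left; rewrite d0 (hs y); have := hle z y; lia.
  by right; apply: ht.
split=> // [x y|x y z|x y z|x y z].
- by apply/eqP/eqP => /h0.
- case: (tri x y z) => [[]//|hf]; rewrite leqNgt; apply/negP => h.
  by apply: hf; constructor 1.
- case: (tri x y z) => [[->]//|hf] ho; rewrite leqNgt; apply/negP => h.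
  by apply: hf; constructor 2.
- case: (tri x y z) => [[->]//|hf] ho; rewrite leqNgt; apply/negP => h.
  apply: hf; constructor 3; split=> //; apply: leq_ltn_trans h.
  by rewrite leq_add2l leq_mul2l geq_minl.
Qed.

Lemma eppa_admissible :
  (forall (A : finType) (d : A -> A -> nat), admissible delta K d ->
    exists (B : finType) (d' : B -> B -> nat) (f : A -> B),
    [/\ admissible delta K d', forall x y, d' (f x) (f y) = d x y &
      forall (D : {set A}) (p : A -> A),
        {in D &, forall x y, d (p x) (p y) = d x y} ->
        exists2 g : {perm B}, forall x y, d' (g x) (g y) = d' x y &
          {in D, forall x, g (f x) = f (p x)}]) ->
  EPPA (antipodal_class delta K).
Proof.
move=> H A /class_admissible[d adm [_ hle hrel]].
have [B [d' [f [adm' hf hext]]]] := H A d adm.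
exists (metric_structure d'); split; first exact: admissible_class.
exists f; split.
  split; last by move=> i x y; rewrite /= hf hrel.
  by move=> x y /eqP; rewrite -(adm_eq0 adm') hf (adm_eq0 adm) => /eqP.
move=> D E p [p_inj _ p_rel].
have p_iso : {in D &, forall x y, d (p x) (p y) = d x y}.
  move=> x y xD yD; case e : (d x y) => [|a].
    have /eqP -> : x == y by rewrite -(adm_eq0 adm) e.
    by apply/eqP; rewrite (adm_eq0 adm).
  have ha : a < delta by rewrite -e.
  by have := p_rel (Ordinal ha) x y xD yD; rewrite !hrel e eqxx => /eqP.
have [g g_iso g_ext] := hext D p p_iso.
by exists g; split=> // i x y; rewrite /= g_iso.
Qed.

End Classes.

(** * The initial system *)

(** One point is treated at a time; injectivity of [f] on [S] keeps each transposition away from the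
    earlier values. *)
Lemma extend_to_perm (T : finType) (S : {set T}) (f : T -> T) :
  {in S &, injective f} -> exists h : {perm T}, {in S, h =1 f}.
Proof.
move=> f_inj; suff [h hh] : exists h : {perm T}, {in enum S, h =1 f}.
  by exists h => x xS; apply: hh; rewrite mem_enum.
have: {subset enum S <= S} by move=> x; rewrite mem_enum.
elim: (enum S) => [|x s IH] sub; first by exists 1%g.
have [y ys|h hh] := IH; first by apply: sub; rewrite inE ys orbT.
have [xs|xs] := boolP (x \in s).
  by exists h => y; rewrite inE => /predU1P[->|]; apply: hh.
exists (h * tperm (h x) (f x))%g => y; rewrite inE permM.
have [-> _|nyx /= ys] := eqVneq y x; first by rewrite tpermL.
have yS : y \in S by apply: sub; rewrite inE ys orbT.
have xS : x \in S by apply: sub; rewrite inE eqxx.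
rewrite -(hh y ys) tpermD // ?(inj_eq perm_inj) 1?eq_sym //.
by apply: contra nyx => /eqP; rewrite hh // => /f_inj ->.
Qed.

Section Colour.
Variables (delta K : nat) (A : finType) (d : A -> A -> nat).
Hypothesis adm : admissible delta K d.
Let bip := K == delta.
Implicit Types (x y z : A).

(** The side of the bipartition, read off from the parity of the distance to one fixed point. *)
Definition colour x := bip && (if [pick y : A] is Some y then odd (d y x) else false).

(** For [K = delta] an odd perimeter would have to equal [2 * delta], so all perimeters are even. *)
Lemma colour_add x y : bip -> colour x (+) colour y = odd (d x y).
Proof.
move=> hb; rewrite /colour hb /=; case: pickP => [z _|/(_ x)] //.
have := @adm_odd_ge _ _ _ _ adm z x y; have := adm_perim adm z x y.
move: hb => /eqP ->; rewrite !oddD => h1 h2.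
have : ~~ odd (d z x + d x y + d z y).
  by apply/negP => ho; move: (ho); rewrite !oddD => /h2; move: h1 ho; lia.
by rewrite !oddD; case: (odd (d z x)); case: (odd (d x y)); case: (odd _).
Qed.

Lemma colour_bip x : ~~ bip -> colour x = false.
Proof. by rewrite /colour => /negPf ->. Qed.

Lemma colour_shift (D : {set A}) (p : A -> A) :
  {in D &, forall x y, d (p x) (p y) = d x y} ->
  exists s, {in D, forall x, colour (p x) = colour x (+) s}.
Proof.
move=> p_iso; have [->|[x xD]] := set_0Vmem D; first by exists false => x; rewrite inE.
exists (colour x (+) colour (p x)) => y yD.
have [hb|hb] := boolP bip; last by rewrite !colour_bip.
have := colour_add (p x) (p y) hb; rewrite p_iso // -colour_add //.
by case: (colour x); case: (colour y); case: (colour (p x)); case: (colour (p y)).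
Qed.

End Colour.

Section Base.
Variables delta K : nat.
Let bip := K == delta.
(** Makes every base value positive; smaller [delta] is treated separately. *)
Hypothesis hdelta : 1 + bip < delta.

(** Whether passing to the antipode changes the colour; otherwise it changes the bits. *)
Let swap := bip && odd delta.
Let half := delta./2.

(* [c] is the parity that a distance must have in the bipartite case; [b] breaks *)
(* the tie between two admissible values equally close to [delta / 2].           *)
Definition base_value (c b : bool) :=
  if bip then
    if odd half == c then half
    else if odd delta || b then half.+1 else half.-1
  else if odd delta && b then half.+1 else half.

Definition tie (c : bool) := if bip then ~~ odd delta && (odd half != c) else odd delta.

Lemma base_value_tie c b b' : ~~ tie c -> base_value c b = base_value c b'.
Proof.
rewrite /tie /base_value; case: (bip); last by case: (odd delta).
by case: (odd delta) => //=; rewrite negbK => ->.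
Qed.

Lemma swap_tie c : swap -> ~~ tie c.
Proof. by rewrite /tie /swap => /andP[-> ->]. Qed.

Lemma half_eq : delta = odd delta + half.*2.
Proof. by rewrite odd_double_half. Qed.

Lemma base_value_anti c b :
  base_value (c (+) swap) (b (+) ~~ swap) = delta - base_value c b.
Proof.
have := half_eq; move: hdelta; rewrite /base_value /swap.
case: (bip); case: (odd delta); case: c; case: b; case: (odd half) => /=;
  rewrite -muln2; lia.
Qed.

Lemma base_value_le c b : base_value c b <= delta.
Proof.
have := half_eq; move: hdelta; rewrite /base_value.
case: (bip); case: (odd delta); case: c; case: b; case: (odd half) => /=;
  rewrite -muln2; lia.
Qed.

Lemma base_value_gt0 c b : 0 < base_value c b.
Proof.
have := half_eq; move: hdelta; rewrite /base_value.
case: (bip); case: (odd delta); case: c; case: b; case: (odd half) => /=;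
  rewrite -muln2; lia.
Qed.

Lemma base_value_lb c b : delta <= (2 * base_value c b).+1 + bip.
Proof.
have := half_eq; move: hdelta; rewrite /base_value.
case: (bip); case: (odd delta); case: c; case: b; case: (odd half) => /=;
  rewrite -muln2; lia.
Qed.

Lemma base_value_odd c b : bip -> odd (base_value c b) = c.
Proof.
have := half_eq; move: hdelta; rewrite /base_value => + + hb; rewrite hb.
case: (odd delta); case: c; case: b; case: (boolP (odd half)) => /=;
  rewrite -?muln2; lia.
Qed.

Section Embedding.
Variables (A : finType) (d : A -> A -> nat).
Hypothesis adm : admissible delta K d.

Notation index := (A * bool)%type.
(** A row holds one bit per index. A tie between two points is broken by the sum of the bits that
    each row holds at the index of the other, which is symmetric. *)
Definition base_point : finType := (index * {ffun index -> bool})%type.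
Implicit Types (x y z : A) (i j : index) (X Y Z : base_point).

Definition base_anti X : base_point :=
  ((X.1.1, X.1.2 (+) swap), [ffun j => X.2 j (+) ~~ swap]).

Definition base_target X Y :=
  base_value (X.1.2 (+) Y.1.2) (X.2 Y.1 (+) Y.2 X.1).

Definition base_edge X Y a :=
  [&& 0 < a < delta, Y != X, Y != base_anti X &
      bip ==> (odd a == odd (base_target X Y))].

Fact base_antiK : involutive base_anti.
Proof.
case=> [[i c] chi]; rewrite /base_anti /= -addbA addbb addbF; congr (_, _).
by apply/ffunP => j; rewrite !ffunE -addbA addbb addbF.
Qed.

Fact base_anti_neq X : base_anti X != X.
Proof.
case: X => [[i c] chi]; rewrite !xpair_eqE eqxx /=.
case: (swap) => /=; first by case: c.
rewrite addbF eqxx; apply/eqP => /ffunP/(_ (i, c)); rewrite ffunE.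
by case: (chi _).
Qed.

Fact base_target_sym X Y : base_target X Y = base_target Y X.
Proof. by rewrite /base_target addbC [X.2 _ (+) _]addbC. Qed.

Fact base_target_anti X Y : base_target (base_anti X) Y = delta - base_target X Y.
Proof.
rewrite /base_target -base_value_anti /= ffunE.
have [hs|hs] := boolP swap.
  rewrite addbAC; apply: base_value_tie; exact: swap_tie.
by rewrite !addbF -surjective_pairing addbAC.
Qed.

Fact base_target_le X Y : base_target X Y <= delta.
Proof. exact: base_value_le. Qed.

Fact base_edge_sym X Y a : base_edge X Y a -> base_edge Y X a.
Proof.
move=> /and4P[h1 h2 h3 h4]; apply/and4P; split=> //; first by rewrite eq_sym.
  by rewrite eq_sym (can2_eq base_antiK base_antiK).
by rewrite base_target_sym.
Qed.

Fact base_edge_anti X Y a : base_edge X Y a -> base_edge (base_anti X) Y (delta - a).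
Proof.
move=> /and4P[h1 h2 h3 h4]; apply/and4P; split=> //; first by lia.
  by rewrite base_antiK.
rewrite base_target_anti !oddB ?base_target_le //; last by lia.
by move: h4; case: (bip) => //= /eqP ->.
Qed.

Fact base_edge_range X Y a : base_edge X Y a -> 0 < a < delta.
Proof. by case/and4P. Qed.

Fact base_edge_neq X Y a : base_edge X Y a -> (Y != X) && (Y != base_anti X).
Proof. by case/and4P => _ -> ->. Qed.

Fact base_edge_parity : bip -> forall X Y a,
  base_edge X Y a -> odd a = odd (base_target X Y).
Proof. by move=> hb X Y a /and4P[_ _ _ /implyP/(_ hb)/eqP]. Qed.

Fact base_target_parity : bip -> forall X Y Z,
  odd (base_target X Y) (+) odd (base_target Y Z) = odd (base_target X Z).
Proof.
move=> hb X Y Z; rewrite !base_value_odd //.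
by rewrite -addbA addKb.
Qed.

Definition base : system delta K := System
  base_antiK base_anti_neq base_edge_sym base_edge_anti base_edge_range
  base_edge_neq base_edge_parity base_target_sym base_target_anti base_target_le
  (fun X Y => base_value_gt0 _ _) (fun X Y => base_value_lb _ _)
  base_target_parity.

Definition coincident x y := (d x y == 0) || (d x y == delta).

Lemma coincidentxx x : coincident x x.
Proof. by rewrite /coincident (adm_eq0 adm) eqxx. Qed.

Lemma coincident_sym x y : coincident x y = coincident y x.
Proof. by rewrite /coincident (adm_sym adm). Qed.

Lemma coincident_trans x y z : coincident x y -> coincident y z -> coincident x z.
Proof.
case/orP; rewrite /coincident; first by rewrite (adm_eq0 adm) => /eqP->.
move=> /eqP h; rewrite (adm_antipode adm z h); have := adm_le adm x z.
by move: hdelta; case: (bip); lia.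
Qed.

Lemma coincidentN x y : ~~ coincident x y = (0 < d x y < delta).
Proof.
by rewrite /coincident negb_or -lt0n [_ < delta]ltn_neqAle (adm_le adm) andbT.
Qed.

(** [pick] depends only on the predicate, so both points of an antipodal pair get the same
    representative. *)
Definition rep x := odflt x [pick y | coincident x y].

Lemma coincident_rep x : coincident x (rep x).
Proof. by rewrite /rep; case: pickP => // _; apply: coincidentxx. Qed.

Lemma rep_eq x y : (rep x == rep y) = coincident x y.
Proof.
apply/eqP/idP => h.
  apply: coincident_trans (coincident_rep x) _.
  by rewrite h coincident_sym coincident_rep.
rewrite /rep (@eq_pick _ _ (coincident y)).
  by case: pickP => // /(_ y); rewrite coincidentxx.
move=> z /=; apply/idP/idP; apply: coincident_trans => //.
by rewrite coincident_sym.
Qed.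

Definition sign x := x != rep x.

Lemma dist_rep x y : d (rep x) y = fl delta (sign x) (d x y).
Proof.
rewrite /sign /fl; case: eqVneq => [<- //|h] /=; apply: (adm_antipode adm).
by have := coincident_rep x; rewrite /coincident (adm_eq0 adm) (negPf h) => /eqP.
Qed.

Lemma sign_antipode x y : d x y = delta -> sign y = ~~ sign x.
Proof.
move=> h; have : rep x == rep y by rewrite rep_eq /coincident h eqxx orbT.
move=> /eqP hr; rewrite /sign -hr -!(adm_eq0 adm) (adm_antipode adm _ h).
have := coincident_rep x; rewrite /coincident.
by move: hdelta; case: (bip); lia.
Qed.

Local Notation colour := (colour delta K d).

Lemma colour_antipode x y : d x y = delta -> colour y = colour x (+) swap.
Proof.
move=> h; rewrite /swap; have [hb|hb] := boolP bip; last by rewrite !colour_bip.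
by have := colour_add adm x y hb; rewrite h /= => <-; rewrite addKb.
Qed.

Definition index_of x : index := (rep x, colour x).

(* The comparison of ranks makes one of the two bits attached to a pair vanish, *)
(* so that their sum tells which side of [delta / 2] the distance lies on.      *)
Definition bits x j := ~~ swap && (sign x (+)
  ((delta < 2 * d (rep x) j.1) && (enum_rank (rep x) < enum_rank j.1))).

Definition base_emb x : base := (index_of x, [ffun j => bits x j]).

Lemma bits_antipode x y j : d x y = delta -> bits y j = bits x j (+) ~~ swap.
Proof.
move=> h; have : rep x == rep y by rewrite rep_eq /coincident h eqxx orbT.
move=> /eqP hr; rewrite /bits -hr (sign_antipode h).
by case: (swap); case: (sign x) => /=; case: (_ && _).
Qed.

Lemma bits_add x y : 0 < d x y < delta -> tie (colour x (+) colour y) ->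
  bits x (index_of y) (+) bits y (index_of x) = (delta < 2 * d x y).
Proof.
move=> hd ht; have hs : swap = false by apply: contraTF ht => /swap_tie.
(* In a tie parity excludes the value [delta / 2], so the distance lies strictly on one side of
   it. *)
have hne : 2 * d x y != delta.
  move: ht; rewrite /tie; case: ifP => [hb|_ ho]; last by apply/eqP; lia.
  rewrite (colour_add adm) // => /andP[ho] hp; apply: contra hp => /eqP e.
  by apply/eqP; congr (odd _); rewrite /half; lia.
have hr : rep x != rep y by rewrite rep_eq coincidentN.
have hD : d (rep x) (rep y) = fl delta (sign x (+) sign y) (d x y).
  rewrite dist_rep (adm_sym adm x) dist_rep (adm_sym adm y).
  by rewrite fl_add // (adm_le adm).
rewrite /bits hs /= (adm_sym adm (rep y)) hD.
have -> : (enum_rank (rep x) < enum_rank (rep y)) =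
    ~~ (enum_rank (rep y) < enum_rank (rep x)).
  rewrite -leqNgt [RHS]leq_eqVlt (inj_eq (@ord_inj _)) (inj_eq enum_rank_inj).
  by rewrite (negPf hr).
by case: (enum_rank _ < _); case: (sign x); case: (sign y) => /=; lia.
Qed.

(** * Extending partial isometries in the initial system *)

Section Extension.
Variables (D : {set A}) (p : A -> A).
Hypothesis p_iso : {in D &, forall x y, d (p x) (p y) = d x y}.

Let coincident_p x y : x \in D -> y \in D ->
  coincident (p x) (p y) = coincident x y.
Proof. by move=> xD yD; rewrite /coincident p_iso. Qed.

Lemma rep_perm : exists h : {perm A}, {in D, forall x, h (rep x) = rep (p x)}.
Proof.
pose f (i : A) := if [pick x in D | rep x == i] is Some x then rep (p x) else i.
have fE x : x \in D -> f (rep x) = rep (p x).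
  move=> xD; rewrite /f; case: pickP => [y /andP[yD]|/(_ x)]; last first.
    by rewrite xD eqxx.
  by rewrite rep_eq -coincident_p // -rep_eq => /eqP.
have [|h hh] := @extend_to_perm A (rep @: D) f.
  move=> _ _ /imsetP[x xD ->] /imsetP[y yD ->]; rewrite !fE // => /eqP.
  by rewrite rep_eq coincident_p // -rep_eq => /eqP.
by exists h => x xD; rewrite hh ?fE // imset_f.
Qed.

Variables (h : {perm A}) (s : bool).
Hypotheses (h_rep : {in D, forall x, h (rep x) = rep (p x)})
  (s_colour : {in D, forall x, colour (p x) = colour x (+) s}).

Definition move_index i : index := (h i.1, i.2 (+) s).
Definition move_back i : index := (h^-1%g i.1, i.2 (+) s).

Lemma move_indexK : cancel move_index move_back.
Proof. by case=> i c; rewrite /move_back /= permK -addbA addbb addbF. Qed.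

Lemma move_backK : cancel move_back move_index.
Proof. by case=> i c; rewrite /move_index /= permKV -addbA addbb addbF. Qed.

Lemma move_index_of x : x \in D -> move_index (index_of x) = index_of (p x).
Proof. by move=> xD; rewrite /move_index /= h_rep // -s_colour. Qed.

Definition defect x j := bits (p x) (move_index j) (+) bits x j.

(* A symmetric correction of the bits, prescribed on the rows indexed by [D]. *)
Definition twist i j :=
  if i \in index_of @: D then [exists x, [&& x \in D, index_of x == i & defect x j]]
  else [exists x, [&& x \in D, index_of x == j & defect x i]].

Lemma defect_const x y j : x \in D -> y \in D -> index_of x = index_of y ->
  defect x j = defect y j.
Proof.
move=> xD yD [/eqP]; rewrite rep_eq /coincident (adm_eq0 adm) => /orP[/eqP->//|].
move=> /eqP e _; have e' : d (p x) (p y) = delta by rewrite p_iso.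
rewrite /defect (bits_antipode _ e) (bits_antipode _ e').
by rewrite addbACA addbb addbF.
Qed.

Lemma twistE x j : x \in D -> twist (index_of x) j = defect x j.
Proof.
move=> xD; rewrite /twist imset_f //.
apply/existsP/idP => [[y /and3P[yD /eqP e]]|hd].
  by rewrite (defect_const _ yD xD e).
by exists x; rewrite xD eqxx.
Qed.

Lemma twist_swap i j : swap -> twist i j = false.
Proof.
move=> hs; have dF x k : defect x k = false by rewrite /defect /bits hs.
rewrite /twist; case: ifP => _; apply/existsP => -[x];
  by rewrite dF !andbF.
Qed.

(** For two distinct indices from [D], [bits_add] determines the sum of the two bits from the
    distance, which [p] preserves, so the two defects agree. Symmetry makes the twist cancel in
    every target. *)
Lemma twist_sym i j : tie (i.2 (+) j.2) -> twist i j = twist j i.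
Proof.
move=> ht; have hs : swap = false by apply: contraTF ht => /swap_tie.
have [/imsetP[x xD ei]|iD] := boolP (i \in index_of @: D); last first.
  have [/imsetP[y yD ej]|jD] := boolP (j \in index_of @: D).
    by rewrite {1}/twist (negPf iD) ej {1}/twist imset_f.
  rewrite /twist (negPf iD) (negPf jD); apply/existsP/existsP => -[x].
    by case/and3P => xD /eqP ej; rewrite -ej imset_f in jD.
  by case/and3P => xD /eqP ei; rewrite -ei imset_f in iD.
rewrite ei in ht *; have [/imsetP[y yD ej]|jD] := boolP (j \in index_of @: D).
  rewrite ej in ht *; rewrite !twistE //.
  have [hc|] := boolP (coincident x y).
    suff e : index_of x = index_of y.
      by rewrite e; apply: defect_const.
    have /eqP hr : rep x == rep y by rewrite rep_eq.
    case/orP: hc => [|/eqP/colour_antipode hc].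
      by rewrite (adm_eq0 adm) => /eqP->.
    by rewrite /index_of hr hc hs addbF.
  rewrite coincidentN => hd; rewrite /defect !move_index_of //.
  have hd' : 0 < d (p x) (p y) < delta by rewrite p_iso.
  have ht' : tie (colour (p x) (+) colour (p y)).
    by rewrite !s_colour // addbACA addbb addbF.
  have := bits_add hd ht; have := bits_add hd' ht'; rewrite p_iso // => <-.
  by do 4 case: (bits _ _).
by rewrite {2}/twist (negPf jD) {1}/twist imset_f.
Qed.

Definition base_map (X : base) : base := (move_index X.1,
  [ffun j => X.2 (move_back j) (+) twist X.1 (move_back j)]).

Lemma base_map_inj : injective base_map.
Proof.
move=> [i chi] [j psi] [/= e1 e2 /ffunP e].
have ij : i = j by apply: (can_inj move_indexK); congr (_, _).
rewrite -ij in e *; congr (_, _); apply/ffunP => l.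
by have := e (move_index l); rewrite !ffunE move_indexK => /addIb.
Qed.

Lemma base_map_target X Y :
  base_target (base_map X) (base_map Y) = base_target X Y.
Proof.
rewrite /base_target /= !ffunE !move_indexK addbACA addbb addbF.
have [ht|ht] := boolP (tie (X.1.2 (+) Y.1.2)); last exact: base_value_tie.
by rewrite (twist_sym ht) addbACA addbb addbF.
Qed.

Lemma base_map_anti X : base_map (base_anti X) = base_anti (base_map X).
Proof.
rewrite /base_map /base_anti /=; congr (_, _).
  by rewrite /move_index /= addbAC.
apply/ffunP => j; rewrite !ffunE addbAC; congr (_ (+) _ (+) _).
have [hs|/negPf hs] := boolP swap; first by rewrite !twist_swap.
by rewrite addbF -surjective_pairing.
Qed.

Lemma base_map_aut : automorphic (perm base_map_inj).
Proof.
split=> [X|X Y a|X Y]; rewrite !permE.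
- exact: base_map_anti.
- rewrite /edge /= /base_edge base_map_target -base_map_anti.
  by rewrite !(inj_eq base_map_inj).
- exact: base_map_target.
Qed.

Lemma base_map_ext x : x \in D -> perm base_map_inj (base_emb x) = base_emb (p x).
Proof.
move=> xD; rewrite permE /base_map /= move_index_of //; congr (_, _).
apply/ffunP => j; rewrite !ffunE twistE // /defect move_backK.
by rewrite addbCA addbb addbF.
Qed.

End Extension.

Lemma base_embeds : embeds d base_emb.
Proof.
split=> [x y hd|x y hd|D p p_iso].
- rewrite /base_emb /= /base_anti /=; congr (_, _).
    rewrite /index_of (colour_antipode hd); congr (_, _); apply/eqP.
    by rewrite rep_eq coincident_sym /coincident hd eqxx orbT.
  by apply/ffunP => j; rewrite !ffunE (bits_antipode _ hd).
- have hr : rep y != rep x by rewrite rep_eq coincidentN (adm_sym adm).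
  rewrite /edge /= /base_edge hd !xpair_eqE (negPf hr) /=.
  apply/implyP => hb; rewrite base_value_odd // -(colour_add adm) //.
- have [h h_rep] := rep_perm p_iso; have [s s_colour] := colour_shift adm p_iso.
  exists (perm (base_map_inj (D := D) (p := p) (h := h) (s := s))).
    exact: base_map_aut.
  by move=> x xD; apply: base_map_ext.
Qed.

End Embedding.
End Base.

(** * Assembly for large [delta], and the trivial case *)

Lemma eppa_large delta K : (K == delta) || (2 * K <= delta) ->
  1 + (K == delta) < delta -> EPPA (antipodal_class delta K).
Proof.
move=> hbip hdelta; have hK : K <= delta by case/orP: hbip; lia.
apply: eppa_admissible => A d adm.
(* A bad walk is shorter than [2 * delta] and has no more steps than its length, so this bound
   removes all bad walks. *)
have [V [e [emb unb]]] :=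
  unwind adm hK (2 * delta).+1 (base_embeds hdelta adm).
have unb' k (x y : V) n : walk k x y n -> ~~ bad x y n.
  move=> w; apply/negP => hb; have hn : n < 2 * delta.
    by move: hb => /orP[/andP[_]|/and3P[_ _]]; lia.
  have hk : k < (2 * delta).+1 by have := walk_leq w; lia.
  by have := unb _ _ _ _ hk w; rewrite hb.
have delta_gt0 : 0 < delta by lia.
exists V, (@dist _ _ V), e; split; first exact: dist_admissible.
  exact: dist_emb.
move=> D p /(emb_ext emb)[g aut_g g_ext]; exists g => //.
exact: dist_aut.
Qed.

Lemma eppa_trivial delta K : delta <= 1 -> EPPA (antipodal_class delta K).
Proof.
move=> hdelta; apply: eppa_admissible => A d adm.
exists A, d, id; split=> // D p p_iso.
have dE x y : d x y = (x != y).
  by rewrite -(adm_eq0 adm); have := adm_le adm x y; lia.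
have [|g g_ext] := @extend_to_perm A D p; last first.
  by exists g => // x y; rewrite !dE (inj_eq perm_inj).
move=> x y xD yD e; apply/eqP; rewrite -(adm_eq0 adm) -p_iso // e.
by rewrite (adm_eq0 adm).
Qed.

(** * The bipartite class of diameter two *)

Section Square.

(** The path metric of the 4-cycle, with the bipartition as first coordinate; every space of the
    class embeds in it. *)
Definition square_dist (u v : bool * bool) :=
  if u.1 == v.1 then (if u.2 == v.2 then 0 else 2) else 1.

Lemma square_admissible : admissible 2 2 square_dist.
Proof.
by split=> [u v|u v|u v w|u v w|u v w|u v w]; case: u v => [[] []] [[] []];
  try case: w => [[] []].
Qed.

Variables (A : finType) (d : A -> A -> nat).
Hypothesis adm : admissible 2 2 d.
Implicit Types (x y z : A).

Local Notation col := (colour 2 2 d).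

Definition side x := x != odflt x [pick y | col y == col x].

(** Distinct points of one colour have distance 2, and three of them would have perimeter 6, so a
    colour class has at most two points. *)
Lemma side_add x y : col x = col y -> side x (+) side y = (x != y).
Proof.
move=> h; rewrite /side h; case: pickP => [r /= /eqP hr|/(_ y)]; last first.
  by rewrite eqxx.
have even u v : col u = col v -> u != v -> d u v = 2.
  move=> huv; have := colour_add adm u v isT; rewrite huv addbb.
  by rewrite -(adm_eq0 adm); have := adm_le adm u v; lia.
case: (eqVneq x y) => [->|nxy]; first by rewrite addbb.
case: (eqVneq x r) nxy => [->|nxr]; first by rewrite eq_sym => ->.
case: (eqVneq y r) => [//|nyr] nxy.
have := adm_perim adm x y r.
by rewrite !even // hr.
Qed.

Definition square_emb x := (col x, side x).

Lemma square_embE x y : square_dist (square_emb x) (square_emb y) = d x y.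
Proof.
have := colour_add adm x y isT; have := adm_le adm x y.
rewrite /square_dist /=; case: eqP => [h|h].
  have -> : (side x == side y) = (d x y == 0).
    rewrite (adm_eq0 adm); have := side_add h.
    by case: (side x); case: (side y); case: (x == y).
  by rewrite h addbb; case: (d x y) => [|[|[|n]]].
by case: (col x) h; case: (col y) => //; case: (d x y) => [|[|[|n]]].
Qed.

Variables (D : {set A}) (p : A -> A).
Hypothesis p_iso : {in D &, forall x y, d (p x) (p y) = d x y}.

Lemma square_ext : exists2 g : {perm bool * bool},
  forall u v, square_dist (g u) (g v) = square_dist u v &
  {in D, forall x, g (square_emb x) = square_emb (p x)}.
Proof.
have [s hs] := colour_shift adm p_iso.
(* Records whether the two vertices of colour [c] have to be exchanged. *)
pose t c := [exists x, [&& x \in D, col x == c & side x (+) side (p x)]].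
have tE x : x \in D -> t (col x) = side x (+) side (p x).
  move=> xD; apply/existsP/idP => [[y /and3P[yD /eqP e]]|h]; last first.
    by exists x; rewrite xD eqxx.
  have e' : col (p y) = col (p x) by rewrite !hs // e.
  have := side_add e; have := side_add e'.
  rewrite -!(adm_eq0 adm) p_iso // => <-.
  by do 4 case: (side _).
pose g (u : bool * bool) := (u.1 (+) s, u.2 (+) t u.1).
have g_inj : injective g.
  by case=> [c b] [c' b'] [/addIb <- /addIb <-].
exists (perm g_inj) => [u v|x xD]; rewrite !permE.
  rewrite /square_dist /= (inj_eq (@addIb s)).
  by case: eqP => [->|//]; rewrite (inj_eq (@addIb _)).
by rewrite /g /square_emb /= tE // hs // addKb.
Qed.

End Square.

Lemma eppa_square : EPPA (antipodal_class 2 2).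
Proof.
apply: eppa_admissible => A d adm.
exists (bool * bool)%type, square_dist, (square_emb d); split.
- exact: square_admissible.
- exact: square_embE.
- by move=> D p; apply: square_ext.
Qed.

Theorem theorem1p2 (delta K : nat)
  (hK : (1 <= K /\ 2 * K <= delta) \/ K = delta) :
  EPPA (antipodal_class delta K).
Proof.
have [hdelta|hdelta] := leqP delta 1; first exact: eppa_trivial.
have [hl|hl] := boolP (1 + (K == delta) < delta).
  by apply: eppa_large => //; case: hK => [[_ ->]|->]; rewrite ?eqxx ?orbT.
have [-> ->] : delta = 2 /\ K = 2 by case: eqP hl => /=; lia.
exact: eppa_square.
Qed.
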